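(* Let $\sigma$ be a constant with $\sigma\ge p/2$, and let $\mathbf{w}^0,\mathbf{w}^1,\ldots,\mathbf{w}^N\in\mathbf{H}$ be the solution of the explicit-implicit scheme $$\frac{\mathbf{w}^{n+1}-\mathbf{w}^{n}}{\tau}+\mathbf{A}_0\big(\sigma\mathbf{w}^{n+1}+(1-\sigma)\mathbf{w}^n\big)+(\mathbf{A}-\mathbf{A}_0)\mathbf{w}^n=\boldsymbol{\varphi}^{n+1},\quad n=0,1,\ldots,N-1,\qquad \mathbf{w}^0=\mathbf{v}^0 .$$ Then the scheme is unconditionally stable: without any restriction on the time step $\tau$, the estimate $$\|\mathbf{w}^{n+1}\|_{\mathbf{A}}^2\le\|\mathbf{v}^0\|_{\mathbf{A}}^2+\frac12\sum_{k=0}^{n}\tau\|\boldsymbol{\varphi}^{k+1}\|^2,\quad n=0,1,\ldots,N-1,$$ holds for the difference solution.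
   Context: Grid problem. Let $l_1,l_2,T>0$, $\Omega=(0,l_1)\times(0,l_2)$, and let $k,c:\Omega\to\mathbb{R}$ satisfy $0<k_1\le k\le k_2$, $0<c_1\le c\le c_2$ with constants $k_1,k_2,c_1,c_2$. For positive integers $N_1,N_2$ put $h_d=l_d/N_d$ and $\omega=\{((i-0.5)h_1,(j-0.5)h_2): 1\le i\le N_1,\ 1\le j\le N_2\}$. $H$ is the finite-dimensional real Hilbert space of grid functions on $\omega$ with $(y,v)=\sum_{x\in\omega}y(x)v(x)h_1h_2$, $\|v\|=(v,v)^{1/2}$. With $e_1=(1,0)$, $e_2=(0,1)$, the operator $A:H\to H$ is $A=A^{(1)}+A^{(2)}$, where for $d=1,2$ $$(A^{(d)}v)(x)=-\frac{1}{h_d^2}k(x+0.5h_de_d)\big(v(x+h_de_d)-v(x)\big)+\frac{1}{h_d^2}k(x-0.5h_de_d)\big(v(x)-v(x-h_de_d)\big)+\frac12c(x)v(x),$$ the first term being omitted when $x_d=l_d-0.5h_d$ and the second when $x_d=0.5h_d$ (homogeneous Neumann boundary conditions). It satisfies $A=A^*\ge\delta I$ with $\delta=c_1$. Given $v^0\in H$ and $\varphi:[0,T]\to H$, the problem to be approximated is $\frac{dv}{dt}+Av=\varphi(t)$, $0<t\le T$, $v(0)=v^0$. Solution decomposition. Let $H_1,\ldots,H_p$ be finite-dimensional Hilbert spaces with scalar products $(\cdot,\cdot)_\alpha$, and let $R_\alpha:H\to H_\alpha$ be linear (restriction) operators with adjoints (extension operators) $R_\alpha^*:H_\alpha\to H$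 such that $\sum_{\alpha=1}^pR_\alpha^*R_\alpha=I$. Let $\mathbf{H}=H_1\oplus\cdots\oplus H_p$ with $(\mathbf{v},\mathbf{y})=\sum_{\alpha=1}^p(v_\alpha,y_\alpha)_\alpha$, $\|\mathbf{v}\|=(\mathbf{v},\mathbf{v})^{1/2}$. The operator matrix $\mathbf{A}:\mathbf{H}\to\mathbf{H}$ is $\mathbf{A}=\{R_\alpha AR_\beta^*\}_{\alpha,\beta=1}^p$, i.e. $(\mathbf{A}\mathbf{v})_\alpha=\sum_{\beta=1}^pR_\alpha AR_\beta^*v_\beta$, and $\|\mathbf{v}\|_{\mathbf{A}}=(\mathbf{A}\mathbf{v},\mathbf{v})^{1/2}$. Its diagonal part is $\mathbf{A}_0=\mathrm{diag}\{R_1AR_1^*,R_2AR_2^*,\ldots,R_pAR_p^*\}$. Put $\mathbf{v}^0=\{R_1v^0,\ldots,R_pv^0\}$ and $\boldsymbol{\varphi}(t)=\{R_1\varphi(t),\ldots,R_p\varphi(t)\}$. Time grid. $N$ is a positive integer, $\tau=T/N$, $t^n=n\tau$, $\boldsymbol{\varphi}^n=\boldsymbol{\varphi}(t^n)$. *)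

(* Defs.v *)
From HB Require Import structures.
From mathcomp Require Import all_boot all_order all_algebra sesquilinear reals.

Set Implicit Arguments.
Unset Strict Implicit.
Unset Printing Implicit Defensive.

Import GRing.Theory.
Local Open Scope ring_scope.

Definition ipnorm (R : realType) (V : lmodType R) (ip : V -> V -> R) (v : V) : R :=
  Num.sqrt (ip v v).

Definition is_adjoint (R : realType) (U V : lmodType R)
    (ipU : U -> U -> R) (ipV : V -> V -> R) (f : U -> V) (g : V -> U) : Prop :=
  forall u v, ipV (f u) v = ipU u (g v).

(* Direct sum of a finite family of spaces, as a module with componentwise
   operations; MathComp only provides this for constant families. *)
Section DirectSum.
Variables (R : realType) (p : nat) (V : 'I_p -> vectType R).

Definition dsum : Type := {dffun forall a : 'I_p, V a}.
HB.instance Definition _ := Choice.on dsum.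

Implicit Types v w : dsum.

Definition dsum_zero : dsum := [ffun a : 'I_p => (0 : V a)].
Definition dsum_opp v : dsum := [ffun a : 'I_p => - v a].
Definition dsum_add v w : dsum := [ffun a : 'I_p => v a + w a].
Definition dsum_scale (r : R) v : dsum := [ffun a : 'I_p => r *: v a].

Fact dsum_addA : associative dsum_add.
Proof. by move=> u v w; apply/ffunP => a; rewrite !ffunE addrA. Qed.
Fact dsum_addC : commutative dsum_add.
Proof. by move=> u v; apply/ffunP => a; rewrite !ffunE addrC. Qed.
Fact dsum_add0 : left_id dsum_zero dsum_add.
Proof. by move=> u; apply/ffunP => a; rewrite !ffunE add0r. Qed.
Fact dsum_addN : left_inverse dsum_zero dsum_opp dsum_add.
Proof. by move=> u; apply/ffunP => a; rewrite !ffunE addNr. Qed.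
HB.instance Definition _ :=
  GRing.isZmodule.Build dsum dsum_addA dsum_addC dsum_add0 dsum_addN.

Fact dsum_scaleA r s v : dsum_scale r (dsum_scale s v) = dsum_scale (r * s) v.
Proof. by apply/ffunP => a; rewrite !ffunE scalerA. Qed.
Fact dsum_scale1 : left_id 1 dsum_scale.
Proof. by move=> v; apply/ffunP => a; rewrite !ffunE scale1r. Qed.
Fact dsum_scaleDr : right_distributive dsum_scale +%R.
Proof. by move=> r v w; apply/ffunP => a; rewrite !ffunE scalerDr. Qed.
Fact dsum_scaleDl v : {morph dsum_scale^~ v : r s / r + s}.
Proof. by move=> r s; apply/ffunP => a; rewrite !ffunE scalerDl. Qed.
HB.instance Definition _ := GRing.Zmodule_isLmodule.Build R dsum
  dsum_scaleA dsum_scale1 dsum_scaleDr dsum_scaleDl.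

Definition dsum_ip (ip : forall a : 'I_p, V a -> V a -> R) v w : R :=
  \sum_a ip a (v a) (w a).

End DirectSum.

(* Ordinals count from 0, so the entry v i j of a grid function v is its value
   at the cell centre ((i + 1/2) h1, (j + 1/2) h2). *)
Section Grid.
Variables (R : realType) (l1 l2 : R) (N1 N2 : nat).

Definition rectangle : pred (R * R) :=
  fun x => (0 < x.1 < l1) && (0 < x.2 < l2).

Let h1 : R := l1 / N1%:R.
Let h2 : R := l2 / N2%:R.

Definition node (i : 'I_N1) (j : 'I_N2) : R * R :=
  ((i%:R + 2^-1) * h1, (j%:R + 2^-1) * h2).

Definition grid_ip (y v : 'M[R]_(N1, N2)) : R :=
  \sum_i \sum_j y i j * v i j * h1 * h2.

Definition ord_next n (i : 'I_n) : option 'I_n := insub i.+1.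
Definition ord_prev n (i : 'I_n) : option 'I_n :=
  if nat_of_ord i is m.+1 then insub m else None.

Variables k c : R * R -> R.

Definition grid_op1 (v : 'M[R]_(N1, N2)) : 'M[R]_(N1, N2) := \matrix_(i, j)
  let x := node i j in
  - (if ord_next i is Some i'
     then (h1 ^+ 2)^-1 * k (x.1 + 2^-1 * h1, x.2) * (v i' j - v i j) else 0)
  + (if ord_prev i is Some i'
     then (h1 ^+ 2)^-1 * k (x.1 - 2^-1 * h1, x.2) * (v i j - v i' j) else 0)
  + 2^-1 * c x * v i j.

Definition grid_op2 (v : 'M[R]_(N1, N2)) : 'M[R]_(N1, N2) := \matrix_(i, j)
  let x := node i j in
  - (if ord_next j is Some j'
     then (h2 ^+ 2)^-1 * k (x.1, x.2 + 2^-1 * h2) * (v i j' - v i j) else 0)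
  + (if ord_prev j is Some j'
     then (h2 ^+ 2)^-1 * k (x.1, x.2 - 2^-1 * h2) * (v i j - v i j') else 0)
  + 2^-1 * c x * v i j.

Definition grid_op (v : 'M[R]_(N1, N2)) : 'M[R]_(N1, N2) :=
  grid_op1 v + grid_op2 v.

End Grid.

Arguments grid_ip {R} l1 l2 {N1 N2} y v.
Arguments grid_op {R} l1 l2 {N1 N2} k c v.

Section Decomposition.
Variables (R : realType) (H : lmodType R) (p : nat) (V : 'I_p -> vectType R).
Variables (Res : forall a, H -> V a) (Ext : forall a, V a -> H).

Definition restrict (v : H) : dsum V := [ffun a : 'I_p => Res a v].

Variable A : H -> H.

Definition op_matrix (v : dsum V) : dsum V :=
  [ffun a : 'I_p => \sum_b Res a (A (Ext (v b)))].

Definition op_diag (v : dsum V) : dsum V :=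
  [ffun a : 'I_p => Res a (A (Ext (v a)))].

Definition energy_ip (ip : forall a, V a -> V a -> R) (v w : dsum V) : R :=
  dsum_ip ip (op_matrix v) w.

End Decomposition.

(* Main.v *)
(** Testing the scheme with [e = w^{n+1} - w^n] and writing
    [2 (A w^n, e) = ||w^{n+1}||_A^2 - ||w^n||_A^2 - ||e||_A^2] leaves the term
    [2 sigma (A_0 e, e) - (A e, e)].  It is nonnegative: [(A e, e)] is the grid
    energy of the sum of the [p] extended components of [e], [(A_0 e, e)] is
    the sum of their energies, and [E (y_1 + ... + y_p) <= p (E y_1 + ... + E y_p)]
    for any nonnegative quadratic form [E].  By Young's inequality
    [2 (phi, e) <= 2 tau^-1 ||e||^2 + (tau / 2) ||phi||^2], and the first term
    is exactly the one contributed by the time derivative. *)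

From HB Require Import structures.
Require Import Defs.
From mathcomp Require Import all_boot all_order all_algebra sesquilinear reals.
From mathcomp Require Import ring lra.

Import Order.TTheory GRing.Theory Num.Theory.

Local Open Scope ring_scope.

(** * Summation by parts on a one-dimensional cell-centred grid *)

Section OrdNeighbours.
Variables (R : realType) (n : nat).

(** A filtered sum with at most one term, unlike the option match, lets the order of summation be
    exchanged. *)
Lemma ord_next_sum (i : 'I_n) (F : 'I_n -> R) :
  (if ord_next i is Some j then F j else 0) = \sum_(j < n | j == i.+1 :> nat) F j.
Proof.
rewrite /ord_next; case: insubP => [j _ ji | /negP ni].
  by rewrite (big_pred1 j) // => j' /=; rewrite -val_eqE ji.
by rewrite big_pred0 // => j; apply/eqP => ji; apply: ni; rewrite -ji ltn_ord.
Qed.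

Lemma ord_prev_sum (i : 'I_n) (F : 'I_n -> R) :
  (if ord_prev i is Some j then F j else 0) = \sum_(j < n | i == j.+1 :> nat) F j.
Proof.
rewrite /ord_prev; case: i => -[|m] /= mn.
  by rewrite big_pred0.
rewrite insubT ?(ltnW mn)// => mn'.
by rewrite (big_pred1 (Ordinal mn')) // => j /=; rewrite -val_eqE eqSS eq_sym.
Qed.

(** Discrete Green formula: the flux through an interior face leaves one cell and enters the next,
    and the hypothesis says that both cells see the same coefficient there. Neumann conditions leave
    no boundary terms. *)
Lemma sum_by_parts (a b u v : 'I_n -> R) :
  (forall i j : 'I_n, j = i.+1 :> nat -> b j = a i) ->
  \sum_i (- (if ord_next i is Some j then a i * (u j - u i) else 0)
          + (if ord_prev i is Some j then b i * (u i - u j) else 0)) * v i =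
  \sum_(i < n) \sum_(j < n | j == i.+1 :> nat) a i * (u j - u i) * (v j - v i).
Proof.
move=> ab.
transitivity (- (\sum_(i < n) \sum_(j < n | j == i.+1 :> nat) a i * (u j - u i) * v i)
   + \sum_(j < n) \sum_(i < n | j == i.+1 :> nat) b j * (u j - u i) * v j).
  rewrite -sumrN -big_split /=; apply: eq_bigr => i _.
  by rewrite ord_next_sum ord_prev_sum mulrDl mulNr !mulr_suml.
(* Both double sums now run over faces, indexed by the cell [i] on their left. *)
rewrite [X in _ + X](exchange_big_dep xpredT) //= addrC -sumrB; apply: eq_bigr => i _.
rewrite -sumrB; apply: eq_bigr => j /eqP /ab ->; ring.
Qed.

End OrdNeighbours.

(** * The grid operator as a symmetric nonnegative form *)

Section GridForm.
Variables (R : realType) (l1 l2 : R) (N1 N2 : nat).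
Hypotheses (l1_gt0 : 0 < l1) (l2_gt0 : 0 < l2).
Implicit Types y v : 'M[R]_(N1, N2).

Lemma grid_ipC y v : grid_ip l1 l2 y v = grid_ip l1 l2 v y.
Proof.
by apply: eq_bigr => i _; apply: eq_bigr => j _; rewrite [y i j * _]mulrC.
Qed.

Fact grid_ip_is_scalar y : scalar (grid_ip l1 l2 y).
Proof.
move=> r u v; rewrite /grid_ip mulr_sumr -big_split; apply: eq_bigr => i _ /=.
rewrite mulr_sumr -big_split; apply: eq_bigr => j _ /=.
by rewrite !mxE; ring.
Qed.

HB.instance Definition _ y :=
  GRing.isLinear.Build R 'M[R]_(N1, N2) R *%R (grid_ip l1 l2 y)
    (grid_ip_is_scalar y).

Variables (k c : R * R -> R).

Let h1 : R := l1 / N1%:R.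
Let h2 : R := l2 / N2%:R.
Let face1 (i : 'I_N1) (j : 'I_N2) : R * R :=
  ((node l1 l2 i j).1 + 2^-1 * h1, (node l1 l2 i j).2).
Let face2 (i : 'I_N1) (j : 'I_N2) : R * R :=
  ((node l1 l2 i j).1, (node l1 l2 i j).2 + 2^-1 * h2).

(** The discrete Dirichlet form of the operator, from which symmetry and nonnegativity can be read
    off; the two halves of the reaction term merge into [c]. *)
Lemma grid_ip_grid_op y v :
  grid_ip l1 l2 (grid_op l1 l2 k c y) v =
  h1 * h2 *
  (\sum_(j < N2) \sum_(i < N1) \sum_(i' < N1 | i' == i.+1 :> nat)
      (h1 ^+ 2)^-1 * k (face1 i j) * (y i' j - y i j) * (v i' j - v i j)
   + \sum_(i < N1) \sum_(j < N2) \sum_(j' < N2 | j' == j.+1 :> nat)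
      (h2 ^+ 2)^-1 * k (face2 i j) * (y i j' - y i j) * (v i j' - v i j)
   + \sum_(i < N1) \sum_(j < N2) c (node l1 l2 i j) * y i j * v i j).
Proof.
transitivity (h1 * h2 * (\sum_(j < N2) \sum_i
  (- (if ord_next i is Some i'
     then (h1 ^+ 2)^-1 * k (face1 i j) * (y i' j - y i j) else 0)
  + (if ord_prev i is Some i'
     then (h1 ^+ 2)^-1 * k ((node l1 l2 i j).1 - 2^-1 * h1, (node l1 l2 i j).2)
       * (y i j - y i' j) else 0)) * v i j
  + \sum_(i < N1) \sum_j
  (- (if ord_next j is Some j'
     then (h2 ^+ 2)^-1 * k (face2 i j) * (y i j' - y i j) else 0)
  + (if ord_prev j is Some j'
     then (h2 ^+ 2)^-1 * k ((node l1 l2 i j).1, (node l1 l2 i j).2 - 2^-1 * h2)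
       * (y i j - y i j') else 0)) * v i j
   + \sum_(i < N1) \sum_(j < N2) c (node l1 l2 i j) * y i j * v i j)).
  rewrite [X in X + _ + _]exchange_big -!big_split mulr_sumr.
  apply: eq_bigr => i _; rewrite -!big_split mulr_sumr.
  apply: eq_bigr => j _; rewrite !mxE -/h1 -/h2 /face1 /face2 /=.
  by field.
congr (_ * (_ + _ + _)); apply: eq_bigr => i _.
  apply: (@sum_by_parts _ _ (fun j => (h1 ^+ 2)^-1 * k (face1 j i))
    (fun j => (h1 ^+ 2)^-1 * k ((node l1 l2 j i).1 - 2^-1 * h1, (node l1 l2 j i).2))
    (fun j => y j i) (fun j => v j i)) => j j' e.
  (* The left face of cell [j + 1] is the right face of cell [j]. *)
  rewrite /face1 /node /= -/h1 e -natr1; congr (_ * k (_, _)).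
  by field.
apply: (@sum_by_parts _ _ (fun j => (h2 ^+ 2)^-1 * k (face2 i j))
  (fun j => (h2 ^+ 2)^-1 * k ((node l1 l2 i j).1, (node l1 l2 i j).2 - 2^-1 * h2))
  (y i) (v i)) => j j' e.
rewrite /face2 /node /= -/h2 e -natr1; congr (_ * k (_, _)).
by field.
Qed.

Lemma grid_op_selfadjoint y v :
  grid_ip l1 l2 (grid_op l1 l2 k c y) v = grid_ip l1 l2 (grid_op l1 l2 k c v) y.
Proof.
rewrite !grid_ip_grid_op; congr (_ * (_ + _ + _)).
- by do 3 (apply: eq_bigr => ? _); rewrite mulrAC.
- by do 3 (apply: eq_bigr => ? _); rewrite mulrAC.
- by do 2 (apply: eq_bigr => ? _); rewrite mulrAC.
Qed.

Hypothesis k_ge0 : forall x, rectangle l1 l2 x -> 0 <= k x.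
Hypothesis c_ge0 : forall x, rectangle l1 l2 x -> 0 <= c x.

Lemma cell_center_bound (l : R) n (i : 'I_n) : 0 < l ->
  0 < (i%:R + 2^-1) * (l / n%:R) < l.
Proof.
move=> l0; have n0 : 0 < n%:R :> R by rewrite ltr0n (leq_ltn_trans _ (ltn_ord i)).
have i0 : 0 <= i%:R :> R by rewrite ler0n.
have iS : i%:R + 1 <= n%:R :> R by rewrite natr1 ler_nat ltn_ord.
rewrite mulr_gt0 ?divr_gt0 //=; last by lra.
rewrite mulrCA gtr_pMr // ltr_pdivrMr //; lra.
Qed.

(** The right face of cell [i] lies at [(i + 1) l / n]; a right neighbour [j] keeps it off the
    boundary, so the bounds on [k] apply there. *)
Lemma cell_face_bound (l : R) n (i j : 'I_n) : 0 < l -> j = i.+1 :> nat ->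
  0 < (i%:R + 2^-1) * (l / n%:R) + 2^-1 * (l / n%:R) < l.
Proof.
move=> l0 ji; have n0 : 0 < n%:R :> R by rewrite ltr0n (leq_ltn_trans _ (ltn_ord i)).
have i0 : 0 <= i%:R :> R by rewrite ler0n.
have iS : i%:R + 1 < n%:R :> R by rewrite natr1 ltr_nat -ji ltn_ord.
rewrite -mulrDl mulr_gt0 ?divr_gt0 //=; last by lra.
rewrite mulrCA gtr_pMr // ltr_pdivrMr //; lra.
Qed.

Lemma grid_op_ge0 v : 0 <= grid_ip l1 l2 (grid_op l1 l2 k c v) v.
Proof.
have h_ge0 (l : R) n : 0 < l -> 0 <= l / n%:R by move=> /ltW l0; rewrite divr_ge0 ?ler0n.
rewrite grid_ip_grid_op; apply: mulr_ge0; first by rewrite mulr_ge0 ?h_ge0.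
apply: addr_ge0; first apply: addr_ge0.
- apply: sumr_ge0 => j _; apply: sumr_ge0 => i _; apply: sumr_ge0 => i' /eqP e.
  rewrite -mulrA mulr_ge0 -?expr2 ?sqr_ge0 // mulr_ge0 ?invr_ge0 ?sqr_ge0 //.
  by apply: k_ge0; rewrite /rectangle /= (cell_face_bound _ _ _ i') // cell_center_bound.
- apply: sumr_ge0 => i _; apply: sumr_ge0 => j _; apply: sumr_ge0 => j' /eqP e.
  rewrite -mulrA mulr_ge0 -?expr2 ?sqr_ge0 // mulr_ge0 ?invr_ge0 ?sqr_ge0 //.
  by apply: k_ge0; rewrite /rectangle /= (cell_face_bound _ _ _ j') // cell_center_bound.
- apply: sumr_ge0 => i _; apply: sumr_ge0 => j _.
  rewrite -mulrA mulr_ge0 -?expr2 ?sqr_ge0 //.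
  by apply: c_ge0; rewrite /rectangle /= !cell_center_bound.
Qed.

End GridForm.

(** * The quadratic form of a sum of [p] vectors *)

Lemma form_sum_le {R : realType} {H : lmodType R} (E : H -> {scalar H})
    (EC : forall y v, E y v = E v y) (E_ge0 : forall v, 0 <= E v v)
    (p : nat) (y : 'I_p -> H) :
  E (\sum_a y a) (\sum_a y a) <= p%:R * \sum_a E (y a) (y a).
Proof.
have E2 u v : 2 * E u v <= E u u + E v v.
  have := E_ge0 (u - v).
  by rewrite linearB /= ![E (u - v) _]EC !linearB /= (EC v u); lra.
have Esum v : E (\sum_a y a) v = \sum_a E (y a) v.
  by rewrite EC linear_sum; apply: eq_bigr => a _; rewrite EC.
(* After doubling, [E2] applies to each of the [p ^ 2] pairs, and every [E (y a) (y a)] is counted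
   [2 p] times. *)
rewrite -(ler_pM2l (ltr0n R 2)) Esum mulr_sumr.
under eq_bigr do rewrite linear_sum mulr_sumr.
apply: (@le_trans _ _ (\sum_a \sum_b (E (y a) (y a) + E (y b) (y b)))).
  by do 2 (apply: ler_sum => ? _).
under eq_bigr do rewrite big_split /= sumr_const card_ord.
rewrite big_split /= sumr_const card_ord sumrMnl -[X in X + _]mulr_natl -[X in _ + X]mulr_natl; lra.
Qed.

(** * Block operators on the direct sum *)

Section DirectSumForm.
Variables (R : realType) (p : nat) (V : 'I_p -> vectType R).
Variable ip : forall a, {dot (V a) for idfun}.
Implicit Types v w : dsum V.

Lemma dsum_ipC v w : dsum_ip ip v w = dsum_ip ip w v.
Proof. by apply: eq_bigr => a _; rewrite hermC expr0 mul1r. Qed.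

Fact dsum_ip_is_scalar v : scalar (dsum_ip ip v).
Proof.
move=> r u w; rewrite /dsum_ip mulr_sumr -big_split; apply: eq_bigr => a _ /=.
by rewrite !ffunE linearDr linearZr.
Qed.

HB.instance Definition _ v :=
  GRing.isLinear.Build R (dsum V) R *%R (dsum_ip ip v) (dsum_ip_is_scalar v).

Lemma dsum_ip_ge0 v : 0 <= dsum_ip ip v v.
Proof.
(* A dot product comes with strict positivity on nonzero vectors, hence the separate zero case. *)
apply: sumr_ge0 => a _; case: (eqVneq (v a) 0) => [->|/neq0_dnorm_gt0/ltW//].
by rewrite linear0l.
Qed.

Variables (H : lmodType R) (ipH : H -> {scalar H}) (A : H -> H).
Variables (Res : forall a, {linear H -> V a}) (Ext : forall a, {linear V a -> H}).
Hypothesis Res_adjoint : forall a, is_adjoint ipH (ip a) (Res a) (Ext a).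
Hypothesis A_selfadjoint : forall y z, ipH (A y) z = ipH (A z) y.
Hypothesis A_ge0 : forall y, 0 <= ipH (A y) y.

Lemma dsum_ip_op_diag v w :
  dsum_ip ip (op_diag Res Ext A v) w = \sum_a ipH (A (Ext a (v a))) (Ext a (w a)).
Proof. by apply: eq_bigr => a _; rewrite ffunE Res_adjoint. Qed.

Lemma dsum_ip_op_matrix v w :
  dsum_ip ip (op_matrix Res Ext A v) w =
  ipH (A (\sum_a Ext a (v a))) (\sum_a Ext a (w a)).
Proof.
rewrite linear_sum; apply: eq_bigr => a _.
(* [A] is a bare function: self-adjointness moves the sum inside it to the second argument of [ipH],
   which is linear. *)
rewrite ffunE linear_sumlz A_selfadjoint linear_sum; apply: eq_bigr => b _.
by rewrite [LHS]Res_adjoint A_selfadjoint.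
Qed.

Lemma op_diag_selfadjoint v w :
  dsum_ip ip (op_diag Res Ext A v) w = dsum_ip ip (op_diag Res Ext A w) v.
Proof. by rewrite !dsum_ip_op_diag; apply: eq_bigr. Qed.

Lemma op_matrix_selfadjoint v w :
  dsum_ip ip (op_matrix Res Ext A v) w = dsum_ip ip (op_matrix Res Ext A w) v.
Proof. by rewrite !dsum_ip_op_matrix. Qed.

Lemma op_matrix_ge0 v : 0 <= dsum_ip ip (op_matrix Res Ext A v) v.
Proof. by rewrite dsum_ip_op_matrix. Qed.

(** [form_sum_le] for the extended components gives the factor [p], and [p <= 2 sigma]. *)
Lemma op_matrix_le_diag (sigma : R) v : p%:R / 2 <= sigma ->
  dsum_ip ip (op_matrix Res Ext A v) v <=
  2 * sigma * dsum_ip ip (op_diag Res Ext A v) v.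
Proof.
move=> sp; rewrite dsum_ip_op_matrix dsum_ip_op_diag.
apply: (le_trans (form_sum_le (fun y => ipH (A y)) A_selfadjoint A_ge0 _ _)).
by apply: ler_wpM2r; [exact: sumr_ge0 | lra].
Qed.

End DirectSumForm.

(** * Energy balance of one time step *)

Lemma two_level_step {R : realType} {W : lmodType R} (D : W -> {scalar W})
    (L L0 : W -> W) (tau sigma : R) (w w' phi : W) :
  (forall u v, D u v = D v u) -> (forall u, 0 <= D u u) ->
  (forall u v, D (L u) v = D (L v) u) ->
  (forall u v, D (L0 u) v = D (L0 v) u) ->
  (forall u, D (L u) u <= 2 * sigma * D (L0 u) u) -> 0 < tau ->
  tau^-1 *: (w' - w) + L0 (sigma *: w' + (1 - sigma) *: w) + (L w - L0 w) = phi ->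
  D (L w') w' <= D (L w) w + 2^-1 * (tau * D phi phi).
Proof.
move=> DC D_ge0 LC L0C LL0 tau_gt0 eq_phi.
have [e w'E] : exists e, w' = w + e by exists (w' - w); rewrite addrC subrK.
(* The weighted value is [w + sigma *: e], so the explicit [- L0 w] cancels the [L0 w] of the
   implicit part. *)
have phi_e : D phi e = tau^-1 * D e e + sigma * D (L0 e) e + D (L w) e.
  have -> : phi = tau^-1 *: e + L0 (w + sigma *: e) + (L w - L0 w).
    rewrite -eq_phi w'E [w + e]addrC addrK; congr (_ + L0 _ + _).
    by rewrite scalerDr scalerBl scale1r -addrA [X in _ + X]addrC subrK addrC.
  rewrite DC !linearD linearN linearZ /= ![D e (L _)]DC ![D e (L0 _)]DC.
  by rewrite [D (L0 (w + _)) e]L0C linearD linearZ /= [D (L0 w) e]L0C; ring.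
(* Young's inequality as the completed square of [(tau / 2) *: phi - e]. *)
have young : 0 <= tau / 2 * D phi phi + 2 * (tau^-1 * D e e) - 2 * D phi e.
  have -> : tau / 2 * D phi phi + 2 * (tau^-1 * D e e) - 2 * D phi e
    = 2 / tau * D ((tau / 2) *: phi - e) ((tau / 2) *: phi - e).
    rewrite linearB linearZ /= ![D (_ - e) _]DC !linearB !linearZ /= [D e phi]DC.
    by field; rewrite gt_eqF.
  by rewrite mulr_ge0 // divr_ge0 // ltW.
have -> : D (L w') w' = D (L w) w + 2 * D (L w) e + D (L e) e.
  by rewrite w'E linearD /= ![D (L (w + e)) _]LC !linearD /= [D (L e) w]LC; ring.
have := LL0 e; lra.
Qed.

(** * Unconditional stability by summing the step estimate *)

Theorem theorem3 (R : realType)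
  (l1 l2 T : R) (hl1 : 0 < l1) (hl2 : 0 < l2) (hT : 0 < T)
  (k1 k2 c1 c2 : R) (k c : R * R -> R)
  (hk1 : 0 < k1) (hc1 : 0 < c1)
  (hk : forall x, rectangle l1 l2 x -> k1 <= k x <= k2)
  (hc : forall x, rectangle l1 l2 x -> c1 <= c x <= c2)
  (N1 N2 : nat) (hN1 : (0 < N1)%N) (hN2 : (0 < N2)%N)
  (v0 : 'M[R]_(N1, N2)) (phi : R -> 'M[R]_(N1, N2))
  (p : nat) (V : 'I_p -> vectType R)
  (ip : forall a, {dot (V a) for idfun})
  (Res : forall a, {linear 'M[R]_(N1, N2) -> V a})
  (Ext : forall a, {linear V a -> 'M[R]_(N1, N2)})
  (hadj : forall a, is_adjoint (grid_ip l1 l2) (ip a) (Res a) (Ext a))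
  (hdec : forall v : 'M[R]_(N1, N2), \sum_a Ext a (Res a v) = v)
  (N : nat) (hN : (0 < N)%N)
  (sigma : R) (hsigma : p%:R / 2 <= sigma)
  (w : nat -> dsum V) :
  let A := grid_op l1 l2 k c in
  let AA := op_matrix Res Ext A in
  let AA0 := op_diag Res Ext A in
  let tau := T / N%:R in
  let Phi n := restrict Res (phi (n%:R * tau)) in
  let normA := ipnorm (energy_ip Res Ext A ip) in
  let norm := ipnorm (dsum_ip ip) in
  w 0%N = restrict Res v0 ->
  (forall n, (n < N)%N ->
     tau^-1 *: (w n.+1 - w n)
     + AA0 (sigma *: w n.+1 + (1 - sigma) *: w n)
     + (AA (w n) - AA0 (w n)) = Phi n.+1) ->
  forall n, (n < N)%N ->
    normA (w n.+1) ^+ 2 <=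
      normA (restrict Res v0) ^+ 2
      + 2^-1 * \sum_(0 <= m < n.+1) tau * norm (Phi m.+1) ^+ 2.
Proof.
move=> A AA AA0 tau Phi normA norm w0 scheme n nN.
have A_sym : forall y v, grid_ip l1 l2 (A y) v = grid_ip l1 l2 (A v) y.
  exact: grid_op_selfadjoint.
have A_ge0 : forall v, 0 <= grid_ip l1 l2 (A v) v.
  apply: grid_op_ge0 => // x hx.
  - by have /andP[/(le_trans (ltW hk1))] := hk x hx.
  - by have /andP[/(le_trans (ltW hc1))] := hc x hx.
have tau_gt0 : 0 < tau by rewrite divr_gt0 // ltr0n.
(* [Num.sqrt] is 0 on negative numbers, so squaring the norm back relies on nonnegativity of the
   form. *)
have normAE v : normA v ^+ 2 = dsum_ip ip (AA v) v.
  by rewrite sqr_sqrtr //; exact: (op_matrix_ge0 R p V ip _ (grid_ip l1 l2) A Res Ext hadj).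
have normE v : norm v ^+ 2 = dsum_ip ip v v.
  by rewrite sqr_sqrtr // dsum_ip_ge0.
have step m : (m < N)%N ->
    normA (w m.+1) ^+ 2 <= normA (w m) ^+ 2 + 2^-1 * (tau * norm (Phi m.+1) ^+ 2).
  move=> mN; rewrite !normAE normE.
  apply: (two_level_step (dsum_ip ip) AA AA0 tau sigma (w m) (w m.+1)) => //.
  - exact: dsum_ipC.
  - exact: dsum_ip_ge0.
  - exact: (op_matrix_selfadjoint R p V ip _ (grid_ip l1 l2) A Res Ext hadj).
  - exact: (op_diag_selfadjoint R p V ip _ (grid_ip l1 l2) A Res Ext hadj).
  - move=> u.
    exact: (op_matrix_le_diag R p V ip _ (grid_ip l1 l2) A Res Ext hadj).
  - exact: scheme.
(* The claim at [n] bounds level [n + 1], so the base case is already one time step from the initial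
   data. *)
elim: n nN => [|n IHn] nN; first by rewrite big_nat1 -w0 step.
rewrite big_nat_recr //= mulrDr addrA.
by apply: (le_trans (step _ nN)); rewrite lerD2r IHn // ltnW.
Qed.
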